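(* Let $\tilde\alpha=\tilde\alpha(\bar s)$ be a unit speed regular dual curve on the dual unit sphere $\tilde S^2$ with dual Darboux frame $\{\tilde e,\tilde t,\tilde g\}$ and dual spherical curvature $\bar\gamma$, and let $\tilde\alpha_1=\frac{1}{\sqrt2}(\tilde e+\tilde t)$ be its dual Smarandache $\tilde e\tilde t$-curve, with dual spherical curvature $\bar\gamma_1$. Then $$\bar\gamma_1=\frac{\bar\gamma^3+2\bar\gamma'+2\bar\gamma}{(2+\bar\gamma^2)^{3/2}} .$$
   Context: Dual numbers are $\bar a=a+\varepsilon a^*$ with $a,a^*\in\mathbb R$, $\varepsilon^2=0$; a differentiable real function is extended by $f(x+\varepsilon x^* )=f(x)+\varepsilon x^*f'(x)$. Dual vectors are $\tilde a=\vec a+\varepsilon\vec a^*$, $\vec a,\vec a^*\in\mathbb R^3$, with $\langle\tilde a,\tilde b\rangle=\langle\vec a,\vec b\rangle+\varepsilon(\langle\vec a,\vec b^*\rangle+\langle\vec a^*,\vec b\rangle)$, $\tilde a\times\tilde b=\vec a\times\vec b+\varepsilon(\vec a\times\vec b^*+\vec a^*\times\vec b)$, and norm $\|\tilde a\|=\|\vec a\|+\varepsilon\langle\vec a,\vec a^*\rangle/\|\vec a\|$ ($\vec a\ne0$). The dual unit sphere $\tilde S^2$ is the set of dual vectors with $\langle\tilde a,\tilde a\rangle=1+\varepsilon0$. Curves are smooth. For a regular dual curve on $\tilde S^2$ with position vector $\tilde e=\tilde\alpha$, $s$ denotes arc-length of the real part $\vec e$ (the real indicatrix), and the dual arc-length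 is $\bar s=\int\|d\tilde e/ds\|\,ds$; ''unit speed'' means that $\bar s$ is used as parameter, and $dF/d\bar s=(dF/ds)/(d\bar s/ds)$. The dual Darboux frame is $\tilde e$, $\tilde t=d\tilde e/d\bar s$, $\tilde g=\tilde e\times\tilde t$, and the dual spherical curvature $\bar\gamma$ is defined by $$\frac{d\tilde e}{d\bar s}=\tilde t,\quad \frac{d\tilde t}{d\bar s}=\bar\gamma\tilde g-\tilde e,\quad \frac{d\tilde g}{d\bar s}=-\bar\gamma\tilde t .$$ Here $\bar\gamma'=d\bar\gamma/d\bar s$. The quantities $\bar s_1,\tilde e_1=\tilde\alpha_1,\tilde t_1,\tilde g_1,\bar\gamma_1$ are the corresponding objects for $\tilde\alpha_1$ (a dual curve on $\tilde S^2$). *)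

(* Defs.v *)
From Stdlib Require Import Reals.
From Coquelicot Require Import Coquelicot.
Open Scope R_scope.

(** * Vectors of R^3 *)

Record vec3 : Type := Vec3 { vx : R; vy : R; vz : R }.

Definition vzero : vec3 := Vec3 0 0 0.
Definition vadd (v w : vec3) : vec3 :=
  Vec3 (vx v + vx w) (vy v + vy w) (vz v + vz w).
Definition vscal (r : R) (v : vec3) : vec3 :=
  Vec3 (r * vx v) (r * vy v) (r * vz v).
Definition vdot (v w : vec3) : R :=
  vx v * vx w + vy v * vy w + vz v * vz w.
Definition vcross (v w : vec3) : vec3 :=
  Vec3 (vy v * vz w - vz v * vy w)
       (vz v * vx w - vx v * vz w)
       (vx v * vy w - vy v * vx w).
Definition vnorm (v : vec3) : R := sqrt (vdot v v).

Definition vderive (f : R -> vec3) (u : R) : vec3 :=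
  Vec3 (Derive (fun r => vx (f r)) u)
       (Derive (fun r => vy (f r)) u)
       (Derive (fun r => vz (f r)) u).

(** * Dual numbers: [Dual x y] is x + eps y with eps^2 = 0 *)

Record dual : Type := Dual { re : R; du : R }.

Definition dreal (r : R) : dual := Dual r 0.
Definition dadd (x y : dual) : dual := Dual (re x + re y) (du x + du y).
Definition dopp (x : dual) : dual := Dual (- re x) (- du x).
Definition dmul (x y : dual) : dual :=
  Dual (re x * re y) (re x * du y + du x * re y).
Fixpoint dpow (x : dual) (n : nat) : dual :=
  match n with O => dreal 1 | S m => dmul x (dpow x m) end.

(** Extension of a real function that is differentiable at [re x]. *)
Definition dlift (f : R -> R) (x : dual) : dual :=
  Dual (f (re x)) (du x * Derive f (re x)).

(** Meaningful for [re x <> 0] only. *)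
Definition dinv (x : dual) : dual := dlift Rinv x.
Definition ddiv (x y : dual) : dual := dmul x (dinv y).

Definition dderive (F : R -> dual) (u : R) : dual :=
  Dual (Derive (fun r => re (F r)) u) (Derive (fun r => du (F r)) u).

Definition dRInt (F : R -> dual) (u0 u : R) : dual :=
  Dual (RInt (fun r => re (F r)) u0 u) (RInt (fun r => du (F r)) u0 u).

(** * Dual vectors *)

Record dvec : Type := DVec { vre : vec3; vdu : vec3 }.

Definition dvadd (A B : dvec) : dvec :=
  DVec (vadd (vre A) (vre B)) (vadd (vdu A) (vdu B)).
Definition dvscal (x : dual) (A : dvec) : dvec :=
  DVec (vscal (re x) (vre A))
       (vadd (vscal (re x) (vdu A)) (vscal (du x) (vre A))).
Definition dvopp (A : dvec) : dvec := dvscal (dreal (-1)) A.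
Definition dvdot (A B : dvec) : dual :=
  Dual (vdot (vre A) (vre B)) (vdot (vre A) (vdu B) + vdot (vdu A) (vre B)).
Definition dvcross (A B : dvec) : dvec :=
  DVec (vcross (vre A) (vre B))
       (vadd (vcross (vre A) (vdu B)) (vcross (vdu A) (vre B))).
(** Meaningful for [vre A <> vzero] only. *)
Definition dvnorm (A : dvec) : dual :=
  Dual (vnorm (vre A)) (vdot (vre A) (vdu A) / vnorm (vre A)).

Definition dvderive (F : R -> dvec) (u : R) : dvec :=
  DVec (vderive (fun r => vre (F r)) u) (vderive (fun r => vdu (F r)) u).

Declare Scope dual_scope.
Delimit Scope dual_scope with D.
Bind Scope dual_scope with dual.
Notation "x + y" := (dadd x y) : dual_scope.
Notation "- x" := (dopp x) : dual_scope.
Notation "x * y" := (dmul x y) : dual_scope.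
Notation "x / y" := (ddiv x y) : dual_scope.
Notation "x ^ n" := (dpow x n) : dual_scope.

Declare Scope dvec_scope.
Delimit Scope dvec_scope with V.
Bind Scope dvec_scope with dvec.
Notation "A + B" := (dvadd A B) : dvec_scope.
Notation "A - B" := (dvadd A (dvopp B)) : dvec_scope.
Notation "x *: A" := (dvscal x A) (at level 40) : dvec_scope.

(** * Dual curves on the dual unit sphere

    A curve is a map of a real parameter [u] ranging over the open interval
    ]a, b[ ([a], [b] possibly infinite); values outside are irrelevant. The
    parameter is arbitrary, so that the same definitions serve for a curve and
    for a second curve built from it, whose arc-lengths differ. *)

Definition in_itv (a b : Rbar) (u : R) : Prop := Rbar_lt a u /\ Rbar_lt u b.

Definition smooth_on (a b : Rbar) (f : R -> R) : Prop :=
  forall (n : nat) (u : R), in_itv a b u -> ex_derive_n f n u.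

Definition vsmooth_on (a b : Rbar) (f : R -> vec3) : Prop :=
  smooth_on a b (fun u => vx (f u)) /\
  smooth_on a b (fun u => vy (f u)) /\
  smooth_on a b (fun u => vz (f u)).

Definition dvsmooth_on (a b : Rbar) (F : R -> dvec) : Prop :=
  vsmooth_on a b (fun u => vre (F u)) /\ vsmooth_on a b (fun u => vdu (F u)).

Definition on_dual_sphere (A : dvec) : Prop := dvdot A A = Dual 1 0.

Definition regular_dual_spherical_curve (a b : Rbar) (e : R -> dvec) : Prop :=
  dvsmooth_on a b e /\
  (forall u, in_itv a b u -> on_dual_sphere (e u)) /\
  (forall u, in_itv a b u -> vderive (fun r => vre (e r)) u <> vzero).

(** Arc-length s of the real indicatrix, measured from [u0]. *)
Definition arclen (u0 : R) (e : R -> dvec) (u : R) : R :=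
  RInt (fun r => vnorm (vderive (fun q => vre (e q)) r)) u0 u.

(** d/ds = (d/du) / (ds/du), on dual functions and on dual vector functions. *)
Definition d_ds (u0 : R) (e : R -> dvec) (F : R -> dual) (u : R) : dual :=
  (dderive F u / dreal (Derive (arclen u0 e) u))%D.
Definition dv_ds (u0 : R) (e : R -> dvec) (F : R -> dvec) (u : R) : dvec :=
  (dinv (dreal (Derive (arclen u0 e) u)) *: dvderive F u)%V.

(** Dual arc-length: the integral of ||de/ds|| ds, with ds = (ds/du) du. *)
Definition dual_arclen (u0 : R) (e : R -> dvec) (u : R) : dual :=
  dRInt (fun r => (dvnorm (dv_ds u0 e e r)
                   * dreal (Derive (arclen u0 e) r))%D) u0 u.

(** Derivatives (dF/ds) / (dsbar/ds) with respect to the dual arc-length. *)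
Definition d_dsbar (u0 : R) (e : R -> dvec) (F : R -> dual) (u : R) : dual :=
  (d_ds u0 e F u / d_ds u0 e (dual_arclen u0 e) u)%D.
Definition dv_dsbar (u0 : R) (e : R -> dvec) (F : R -> dvec) (u : R) : dvec :=
  (dinv (d_ds u0 e (dual_arclen u0 e) u) *: dv_ds u0 e F u)%V.

(** The Darboux frame is [e], [darboux_t u0 e], [darboux_g u0 e]. *)
Definition darboux_t (u0 : R) (e : R -> dvec) : R -> dvec := dv_dsbar u0 e e.
Definition darboux_g (u0 : R) (e : R -> dvec) (u : R) : dvec :=
  dvcross (e u) (darboux_t u0 e u).

(** The remaining Darboux equation, de/dsbar = t, is the definition of t. *)
Definition is_dual_spherical_curvature (a b : Rbar) (u0 : R)
    (e : R -> dvec) (gamma : R -> dual) : Prop :=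
  forall u, in_itv a b u ->
    (dv_dsbar u0 e (darboux_t u0 e) u = gamma u *: darboux_g u0 e u - e u)%V /\
    (dv_dsbar u0 e (darboux_g u0 e) u = (- gamma u)%D *: darboux_t u0 e u)%V.

Definition smarandache_et (u0 : R) (e : R -> dvec) (u : R) : dvec :=
  (dreal (1 / sqrt 2) *: (e u + darboux_t u0 e u))%V.

(* Main.v *)
Require Import Defs.
From Stdlib Require Import Reals Lra.
From Coquelicot Require Import Coquelicot.
Open Scope R_scope.

(** Dual numbers form a commutative ring in which an element with positive real
    part is invertible and has a unique square root with positive real part, so
    the classical computation goes through over this ring. With [lam = dsbar/du],
    the derivative d/dsbar is [lam^-1 d/du]. In the frame (e, t, g), the curve
    e1 = (e + t) / sqrt 2 has derivative lam (-e + t + gamma g) / sqrt 2, of norm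
    lam rho / sqrt 2 with rho^2 = 2 + gamma^2; hence t1 = (-e + t + gamma g) / rho,
    and gamma1 is the inner product of dt1/dsbar1 with g1 = e1 x t1. *)

(** * Repeated differentiability on an open interval *)

Lemma locally_itv (a b : Rbar) (u : R) :
  in_itv a b u -> locally u (in_itv a b).
Proof.
  intros [ha hb].
  apply filter_and.
  - apply (open_Rbar_gt a u ha).
  - apply (open_Rbar_lt b u hb).
Qed.

Lemma in_itv_between (a b : Rbar) (u v w : R) :
  in_itv a b u -> in_itv a b v -> Rmin u v <= w <= Rmax u v -> in_itv a b w.
Proof.
  intros [hau hub] [hav hvb].
  unfold Rmin, Rmax, in_itv.
  destruct a, b; simpl in *; try tauto; destruct (Rle_dec u v); intros; split; trivial; lra.
Qed.

(** Recursion peels off the innermost derivative: [f] is differentiable and [Derive f] is one order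
    less so. The rules for sums, products, inverses and roots then go by induction on [n], which the
    outermost recursion of [Derive_n] does not suit. *)
Fixpoint ndiff (a b : Rbar) (n : nat) (f : R -> R) : Prop :=
  match n with
  | O => True
  | S m => (forall u, in_itv a b u -> ex_derive f u) /\ ndiff a b m (Derive f)
  end.

Definition smooth (a b : Rbar) (f : R -> R) : Prop := forall n, ndiff a b n f.

Lemma locally_eq_itv (T : Type) (a b : Rbar) (f g : R -> T) (u : R) :
  (forall r, in_itv a b r -> f r = g r) -> in_itv a b u ->
  locally u (fun r => f r = g r).
Proof.
  intros H hu; apply (filter_imp (in_itv a b)); [exact H | now apply locally_itv].
Qed.

Lemma Derive_ext_itv (a b : Rbar) (f g : R -> R) (u : R) :
  (forall r, in_itv a b r -> f r = g r) -> in_itv a b u ->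
  Derive f u = Derive g u.
Proof. intros H hu; apply Derive_ext_loc; now apply (locally_eq_itv _ a b). Qed.

(** The interval is open, so agreement on it is agreement near each of its points and passes to
    derivatives. This lets a differentiation rule replace [Derive] of an expression inside the
    inductions below. *)
Lemma ndiff_ext (a b : Rbar) (n : nat) : forall f g : R -> R,
  (forall u, in_itv a b u -> f u = g u) -> ndiff a b n f -> ndiff a b n g.
Proof.
  induction n as [|n IH]; simpl; trivial.
  intros f g H [hd hn]; split.
  - intros u hu; apply (ex_derive_ext_loc f); [now apply (locally_eq_itv _ a b) | auto].
  - apply (IH (Derive f)); trivial.
    intros u hu; now apply (Derive_ext_itv a b).
Qed.

Lemma ndiff_pred (a b : Rbar) (n : nat) : forall f : R -> R,
  ndiff a b (S n) f -> ndiff a b n f.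
Proof.
  induction n as [|n IH]; [simpl; trivial|].
  intros f [hd hn]; split; [exact hd | now apply IH].
Qed.

Lemma ndiff_const (a b : Rbar) (n : nat) : forall c : R, ndiff a b n (fun _ => c).
Proof.
  induction n as [|n IH]; simpl; trivial.
  intros c; split; [intros; apply ex_derive_const|].
  apply (ndiff_ext a b n (fun _ => 0)); trivial.
  intros; now rewrite Derive_const.
Qed.

Lemma ndiff_plus (a b : Rbar) (n : nat) : forall f g : R -> R,
  ndiff a b n f -> ndiff a b n g -> ndiff a b n (fun u => f u + g u).
Proof.
  induction n as [|n IH]; simpl; trivial.
  intros f g [hf hf'] [hg hg']; split.
  - intros u hu; apply (ex_derive_plus f g); auto.
  - apply (ndiff_ext a b n (fun u => Derive f u + Derive g u)); auto.
    intros u hu; symmetry; apply Derive_plus; auto.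
Qed.

Lemma ndiff_mult (a b : Rbar) (n : nat) : forall f g : R -> R,
  ndiff a b n f -> ndiff a b n g -> ndiff a b n (fun u => f u * g u).
Proof.
  induction n as [|n IH]; simpl; trivial.
  intros f g hf hg; split.
  - intros u hu; apply ex_derive_mult; [apply hf | apply hg]; trivial.
  - apply (ndiff_ext a b n (fun u => Derive f u * g u + f u * Derive g u)).
    + intros u hu; symmetry; apply Derive_mult; [apply hf | apply hg]; trivial.
    + apply ndiff_plus; apply IH; try apply hf; try apply hg; now apply ndiff_pred.
Qed.

(** The derivative of [/ f] is [Derive f] times a polynomial in [/ f] itself, so the induction
    hypothesis for the same [f] suffices and [f] stays fixed. *)
Lemma ndiff_inv (a b : Rbar) (f : R -> R) (n : nat) :
  (forall u, in_itv a b u -> f u <> 0) ->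
  ndiff a b n f -> ndiff a b n (fun u => / f u).
Proof.
  intros h0; induction n as [|n IH]; simpl; trivial.
  intros hf; split.
  - intros u hu; apply ex_derive_inv; [apply hf | apply h0]; trivial.
  - apply (ndiff_ext a b n (fun u => Derive f u * (-1 * (/ f u * / f u)))).
    + intros u hu; rewrite Derive_inv; [|apply hf; trivial|apply h0; trivial].
      field; now apply h0.
    + assert (hi : ndiff a b n (fun u => / f u)) by (apply IH; now apply ndiff_pred).
      repeat apply ndiff_mult; trivial; [apply hf | apply ndiff_const].
Qed.

(** Same bootstrap as for the inverse: the derivative of the root is [Derive f] over twice the root,
    and the root is [n] times differentiable by induction. *)
Lemma ndiff_sqrt (a b : Rbar) (f : R -> R) (n : nat) :
  (forall u, in_itv a b u -> 0 < f u) ->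
  ndiff a b n f -> ndiff a b n (fun u => sqrt (f u)).
Proof.
  intros h0; induction n as [|n IH]; simpl; trivial.
  intros hf.
  assert (hd : forall u, in_itv a b u ->
            is_derive (fun r => sqrt (f r)) u (Derive f u * / (2 * sqrt (f u)))).
  { intros u hu; apply (is_derive_sqrt f); [apply Derive_correct, hf | apply h0]; trivial. }
  split.
  - intros u hu; eexists; now apply hd.
  - apply (ndiff_ext a b n (fun u => Derive f u * / (2 * sqrt (f u)))).
    + intros u hu; symmetry; apply is_derive_unique; auto.
    + apply ndiff_mult; [apply hf|].
      apply (ndiff_inv a b (fun u => 2 * sqrt (f u))).
      * intros u hu; pose proof (sqrt_lt_R0 _ (h0 u hu)); lra.
      * apply (ndiff_mult a b n (fun _ => 2)); [apply ndiff_const|].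
        apply IH; now apply ndiff_pred.
Qed.

Lemma smooth_on_smooth (a b : Rbar) (f : R -> R) : smooth_on a b f -> smooth a b f.
Proof.
  intros hf n; revert f hf.
  induction n as [|n IH]; simpl; trivial.
  intros f hf; split.
  - exact (hf 1%nat).
  - apply IH; intros [|m] u hu; simpl; trivial.
    (* The order-[m] derivative of [Derive f] is the order-[m + 1] derivative of [f]; this moves the
       extra derivative from the inside to the outside. *)
    apply (ex_derive_ext (Derive_n f (m + 1))).
    + intros r; symmetry; apply (Derive_n_comp f m 1).
    + rewrite PeanoNat.Nat.add_1_r; exact (hf (S (S m)) u hu).
Qed.

Lemma smooth_ex_derive (a b : Rbar) (f : R -> R) (u : R) :
  smooth a b f -> in_itv a b u -> ex_derive f u.
Proof. intros hf; apply (hf 1%nat). Qed.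

Lemma Derive_RInt_itv (a b : Rbar) (u0 u : R) (f : R -> R) :
  in_itv a b u0 -> in_itv a b u -> smooth a b f ->
  Derive (RInt f u0) u = f u.
Proof.
  intros hu0 hu hf.
  assert (hc : forall r, in_itv a b r -> continuous f r).
  { intros r hr; apply (ex_derive_continuous f r); now apply (smooth_ex_derive a b). }
  apply is_derive_unique, (is_derive_RInt f _ u0); [|now apply hc].
  apply (filter_imp (in_itv a b)); [|now apply locally_itv].
  intros r hr; apply (RInt_correct f), ex_RInt_continuous.
  intros z hz; apply hc; now apply (in_itv_between a b u0 r).
Qed.

(** * The algebra of dual numbers *)

Ltac dual_ext :=
  repeat match goal with x : dual |- _ => destruct x end;
  unfold ddiv, dadd, dmul, dopp, dreal; simpl; apply (f_equal2 Dual).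

(** Registered just below, so that [ring] decides polynomial identities between dual numbers without
    splitting them into components. *)
Lemma dual_ring : ring_theory (dreal 0) (dreal 1) dadd dmul
  (fun x y => dadd x (dopp y)) dopp eq.
Proof. constructor; intros; dual_ext; ring. Qed.

Add Ring dual_ring : dual_ring.

Lemma dreal_mul (x y : R) : dreal (x * y) = (dreal x * dreal y)%D.
Proof. dual_ext; ring. Qed.

(** To [ring], [dreal 2] is an atom; this rewriting turns it into a sum of units. *)
Lemma dreal_2 : dreal 2 = (dreal 1 + dreal 1)%D.
Proof. unfold dreal, dadd; simpl; apply (f_equal2 Dual); ring. Qed.

Lemma dinv_eq (x : dual) : re x <> 0 ->
  dinv x = Dual (/ re x) (- du x * (/ re x * / re x)).
Proof.
  intros hx; unfold dinv, dlift; f_equal.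
  rewrite (Derive_inv (fun r => r)); [|apply ex_derive_id|exact hx].
  rewrite Derive_id; field; exact hx.
Qed.

Lemma dmul_dinv (x : dual) : re x <> 0 -> (x * dinv x)%D = dreal 1.
Proof. intros hx; rewrite dinv_eq by exact hx; dual_ext; simpl in *; now field. Qed.

(** The real part of a product is the product of the real parts, so the equation forces [re x] to be
    nonzero, and inverses are unique in a commutative ring. Inverses are identified below by
    checking one product. *)
Lemma dinv_unique (x y : dual) : (x * y)%D = dreal 1 -> dinv x = y.
Proof.
  intros h.
  assert (hx : re x <> 0).
  { intros h0; apply (f_equal re) in h; simpl in h; rewrite h0 in h; lra. }
  transitivity ((x * dinv x) * y)%D.
  - transitivity (dinv x * (x * y))%D; [rewrite h|]; ring.
  - rewrite dmul_dinv by exact hx; ring.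
Qed.

Lemma dlift_sqrt_eq (x : dual) : 0 < re x ->
  dlift sqrt x = Dual (sqrt (re x)) (du x * / (2 * sqrt (re x))).
Proof.
  intros hx; unfold dlift; do 2 f_equal.
  apply is_derive_unique.
  replace (/ (2 * sqrt (re x))) with (1 * / (2 * sqrt (re x))) by ring.
  apply (is_derive_sqrt (fun r => r)); [apply @is_derive_id | exact hx].
Qed.

Lemma dlift_sqrt_sqr (x : dual) : 0 < re x ->
  (dlift sqrt x * dlift sqrt x)%D = x.
Proof.
  intros hx; rewrite dlift_sqrt_eq by exact hx.
  pose proof (sqrt_lt_R0 _ hx); pose proof (sqrt_sqrt (re x) (Rlt_le _ _ hx)).
  dual_ext; simpl in *; [assumption | field; lra].
Qed.

(** Real parts agree by positivity; the dual parts then satisfy 2xx' = 2xy', and x > 0 can be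
    cancelled. *)
Lemma dsqr_inj (x y : dual) : 0 < re x -> 0 < re y -> (x * x = y * y)%D -> x = y.
Proof.
  destruct x as [x x'], y as [y y']; unfold dmul; simpl; intros hx hy h.
  injection h; intros h2 h1.
  assert (x = y) by nra; subst y; f_equal; nra.
Qed.

(** By the chain rule the dual part is (3/2) x times 2xx', that is 3x²x', which is the dual part of
    the cube. *)
Lemma dlift_Rpower_sqr (x : dual) : 0 < re x ->
  dlift (fun r => Rpower r (3 / 2)) (x * x)%D = (x * (x * x))%D.
Proof.
  destruct x as [x x']; simpl; intros hx; unfold dlift; simpl.
  (* One evaluation at half-integer exponents serves the value, with n = 3, and the derivative, with
     n = 1. *)
  assert (hp : forall n : nat, Rpower (x * x) (INR n / 2) = x ^ n).
  { intros n; replace (x * x) with (Rpower x 2).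
    - rewrite Rpower_mult; replace (2 * (INR n / 2)) with (INR n) by field.
      now apply Rpower_pow.
    - replace 2 with (INR 2) by (simpl; lra); rewrite Rpower_pow by exact hx; simpl; ring. }
  assert (hd : Derive (fun r => Rpower r (3 / 2)) (x * x) = 3 / 2 * Rpower (x * x) (3 / 2 - 1)).
  { apply is_derive_unique, is_derive_Reals, derivable_pt_lim_power; nra. }
  rewrite hd.
  replace (3 / 2 - 1) with (INR 1 / 2) by (simpl; lra).
  replace (Rpower (x * x) (3 / 2)) with (Rpower (x * x) (INR 3 / 2)) by (do 2 f_equal; simpl; lra).
  rewrite !hp; unfold dmul; simpl; f_equal; field.
Qed.

(** * Dual vectors *)

(** A dual vector is also a triple of dual numbers. In these coordinates dot and cross products have
    their classical formulas, so vector identities become ring identities. *)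
Definition dX (A : dvec) : dual := Dual (vx (vre A)) (vx (vdu A)).
Definition dY (A : dvec) : dual := Dual (vy (vre A)) (vy (vdu A)).
Definition dZ (A : dvec) : dual := Dual (vz (vre A)) (vz (vdu A)).

Ltac dvec_ext :=
  repeat match goal with
  | A : dvec |- _ => destruct A as [[] []]
  | x : dual |- _ => destruct x
  end;
  unfold dX, dY, dZ, dvdot, dvcross, dvopp, dvadd, dvscal, vdot, vcross, vadd, vscal,
    dadd, dmul, dopp, dreal; simpl;
  repeat first [apply (f_equal2 Dual) | apply (f_equal2 DVec) | apply (f_equal3 Vec3)].

Lemma dvec_eq (A B : dvec) : dX A = dX B -> dY A = dY B -> dZ A = dZ B -> A = B.
Proof.
  destruct A as [[] []], B as [[] []]; unfold dX, dY, dZ; simpl; congruence.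
Qed.

Lemma dvdot_coord (A B : dvec) :
  dvdot A B = (dX A * dX B + dY A * dY B + dZ A * dZ B)%D.
Proof. dvec_ext; ring. Qed.

Lemma dX_add (A B : dvec) : dX (A + B)%V = (dX A + dX B)%D.
Proof. reflexivity. Qed.
Lemma dX_scal (x : dual) (A : dvec) : dX (x *: A)%V = (x * dX A)%D.
Proof. dvec_ext; ring. Qed.
Lemma dX_opp (A : dvec) : dX (dvopp A) = (- dX A)%D.
Proof. dvec_ext; ring. Qed.
Lemma dX_cross (A B : dvec) :
  dX (dvcross A B) = (dY A * dZ B + - (dZ A * dY B))%D.
Proof. dvec_ext; ring. Qed.

Lemma dY_add (A B : dvec) : dY (A + B)%V = (dY A + dY B)%D.
Proof. reflexivity. Qed.
Lemma dY_scal (x : dual) (A : dvec) : dY (x *: A)%V = (x * dY A)%D.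
Proof. dvec_ext; ring. Qed.
Lemma dY_opp (A : dvec) : dY (dvopp A) = (- dY A)%D.
Proof. dvec_ext; ring. Qed.
Lemma dY_cross (A B : dvec) :
  dY (dvcross A B) = (dZ A * dX B + - (dX A * dZ B))%D.
Proof. dvec_ext; ring. Qed.

Lemma dZ_add (A B : dvec) : dZ (A + B)%V = (dZ A + dZ B)%D.
Proof. reflexivity. Qed.
Lemma dZ_scal (x : dual) (A : dvec) : dZ (x *: A)%V = (x * dZ A)%D.
Proof. dvec_ext; ring. Qed.
Lemma dZ_opp (A : dvec) : dZ (dvopp A) = (- dZ A)%D.
Proof. dvec_ext; ring. Qed.
Lemma dZ_cross (A B : dvec) :
  dZ (dvcross A B) = (dX A * dY B + - (dY A * dX B))%D.
Proof. dvec_ext; ring. Qed.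

Create HintDb dvec.
Hint Rewrite dvdot_coord dX_add dY_add dZ_add dX_scal dY_scal dZ_scal
  dX_opp dY_opp dZ_opp dX_cross dY_cross dZ_cross : dvec.

Ltac dvec_ring :=
  lazymatch goal with |- _ = _ :> dvec => apply dvec_eq | _ => idtac end;
  autorewrite with dvec;
  ring.

Lemma dvscal_dvscal (x y : dual) (A : dvec) : (x *: (y *: A) = (x * y)%D *: A)%V.
Proof. dvec_ring. Qed.

Lemma dvscal_1 (A : dvec) : (dreal 1 *: A)%V = A.
Proof. dvec_ring. Qed.

Lemma dvdot_scal_l (x : dual) (A B : dvec) : dvdot (x *: A)%V B = (x * dvdot A B)%D.
Proof. dvec_ring. Qed.

Lemma dvdot_scal_r (x : dual) (A B : dvec) : dvdot A (x *: B)%V = (x * dvdot A B)%D.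
Proof. dvec_ring. Qed.

Lemma dvdot_sub_l (A B C : dvec) : dvdot (A - B)%V C = (dvdot A C + - dvdot B C)%D.
Proof. dvec_ring. Qed.

Lemma dvdot_cross_l (A B : dvec) : dvdot A (dvcross A B) = dreal 0.
Proof. dvec_ring. Qed.

(** Lagrange's identity over the dual numbers; it gives the third frame vector its unit length. *)
Lemma dvdot_cross_cross (A B : dvec) :
  dvdot (dvcross A B) (dvcross A B)
  = (dvdot A A * dvdot B B + - (dvdot A B * dvdot A B))%D.
Proof. dvec_ring. Qed.

Lemma dvdot_self_pos (A : dvec) : vre A <> vzero -> 0 < re (dvdot A A).
Proof.
  destruct A as [[x y z] w]; unfold dvdot, vdot, vzero; simpl; intros h.
  destruct (Rle_lt_dec (x * x + y * y + z * z) 0) as [h0|]; trivial.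
  exfalso; apply h.
  pose proof (Rle_0_sqr x); pose proof (Rle_0_sqr y); pose proof (Rle_0_sqr z).
  unfold Rsqr in *.
  f_equal; apply Rsqr_0_uniq; unfold Rsqr; lra.
Qed.

Lemma dvnorm_pos (A : dvec) : vre A <> vzero -> 0 < re (dvnorm A).
Proof. intros h; apply sqrt_lt_R0; exact (dvdot_self_pos A h). Qed.

(** The dual part of the squared norm is twice the product of [vre A] and [vdu A]; the 2 cancels
    against the derivative of the root. The norm thus inherits smoothness and its square from
    [dlift sqrt]. *)
Lemma dvnorm_sqrt (A : dvec) : vre A <> vzero -> dvnorm A = dlift sqrt (dvdot A A).
Proof.
  intros h; pose proof (dvdot_self_pos A h) as hp.
  pose proof (dvnorm_pos A h) as hn.
  rewrite dlift_sqrt_eq by exact hp; unfold dvnorm; simpl in *; f_equal.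
  unfold vnorm in *; set (s := sqrt _) in *.
  replace (vdot (vdu A) (vre A)) with (vdot (vre A) (vdu A)) by (unfold vdot; ring).
  field; lra.
Qed.

Lemma dvnorm_sqr (A : dvec) : vre A <> vzero ->
  (dvnorm A * dvnorm A)%D = dvdot A A.
Proof.
  intros h; rewrite dvnorm_sqrt by exact h.
  apply dlift_sqrt_sqr; now apply dvdot_self_pos.
Qed.

Lemma vre_neq0 (A : dvec) : 0 < re (dvdot A A) -> vre A <> vzero.
Proof.
  destruct A as [v w]; unfold dvdot, vdot; simpl; intros h ->; simpl in h; lra.
Qed.

(** Norms are computed by exhibiting a square root with positive real part, which is unique by
    [dsqr_inj]. *)
Lemma dvnorm_unique (A : dvec) (x : dual) :
  0 < re x -> dvdot A A = (x * x)%D -> dvnorm A = x.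
Proof.
  intros hx h.
  assert (hA : vre A <> vzero) by (apply vre_neq0; rewrite h; simpl; nra).
  apply dsqr_inj; [now apply dvnorm_pos | exact hx | now rewrite dvnorm_sqr].
Qed.

(** * Smooth dual functions and dual curves *)

Definition dsmooth (a b : Rbar) (F : R -> dual) : Prop :=
  smooth a b (fun r => re (F r)) /\ smooth a b (fun r => du (F r)).

Lemma dsmooth_ext (a b : Rbar) (F G : R -> dual) :
  (forall u, in_itv a b u -> F u = G u) -> dsmooth a b F -> dsmooth a b G.
Proof.
  intros H [h1 h2]; split; intros n.
  - apply (ndiff_ext a b n (fun r => re (F r))); [intros; f_equal; auto | apply h1].
  - apply (ndiff_ext a b n (fun r => du (F r))); [intros; f_equal; auto | apply h2].
Qed.

Lemma dsmooth_const (a b : Rbar) (x : dual) : dsmooth a b (fun _ => x).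
Proof. split; intros n; apply ndiff_const. Qed.

Lemma dsmooth_add (a b : Rbar) (F G : R -> dual) :
  dsmooth a b F -> dsmooth a b G -> dsmooth a b (fun u => F u + G u)%D.
Proof. intros [] []; split; intros n; simpl; apply ndiff_plus; auto. Qed.

Lemma dsmooth_mul (a b : Rbar) (F G : R -> dual) :
  dsmooth a b F -> dsmooth a b G -> dsmooth a b (fun u => F u * G u)%D.
Proof.
  intros [h1 h2] [h3 h4]; split; intros n; simpl; [apply ndiff_mult; auto|].
  apply (ndiff_plus a b n (fun u => re (F u) * du (G u))); apply ndiff_mult; auto.
Qed.

Lemma dsmooth_opp (a b : Rbar) (F : R -> dual) :
  dsmooth a b F -> dsmooth a b (fun u => - F u)%D.
Proof.
  intros h; apply (dsmooth_ext a b (fun u => dreal (-1) * F u)%D).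
  - intros u _; destruct (F u); unfold dmul, dopp; simpl; f_equal; ring.
  - apply dsmooth_mul; [apply dsmooth_const | exact h].
Qed.

Lemma dsmooth_dinv (a b : Rbar) (F : R -> dual) :
  (forall u, in_itv a b u -> re (F u) <> 0) ->
  dsmooth a b F -> dsmooth a b (fun u => dinv (F u)).
Proof.
  intros h0 [h1 h2].
  apply (dsmooth_ext a b
    (fun u => Dual (/ re (F u)) (-1 * du (F u) * (/ re (F u) * / re (F u))))).
  - intros u hu; rewrite dinv_eq by auto; f_equal; ring.
  - assert (hi : smooth a b (fun u => / re (F u))).
    { intros n; now apply (ndiff_inv a b (fun u => re (F u))). }
    split; intros n; [apply hi|].
    repeat apply ndiff_mult; auto; apply ndiff_const.
Qed.

Lemma dsmooth_sqrt (a b : Rbar) (F : R -> dual) :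
  (forall u, in_itv a b u -> 0 < re (F u)) ->
  dsmooth a b F -> dsmooth a b (fun u => dlift sqrt (F u)).
Proof.
  intros h0 [h1 h2].
  apply (dsmooth_ext a b
    (fun u => Dual (sqrt (re (F u))) (du (F u) * / (2 * sqrt (re (F u)))))).
  - intros u hu; now rewrite dlift_sqrt_eq by auto.
  - assert (hs : smooth a b (fun u => sqrt (re (F u)))).
    { intros n; now apply (ndiff_sqrt a b (fun u => re (F u))). }
    split; intros n; [apply hs|].
    apply ndiff_mult; [apply h2|].
    apply (ndiff_inv a b (fun u => 2 * sqrt (re (F u)))).
    + intros u hu; pose proof (sqrt_lt_R0 _ (h0 u hu)); lra.
    + apply (ndiff_mult a b n (fun _ => 2)); [apply ndiff_const | apply hs].
Qed.

Lemma dsmooth_dderive (a b : Rbar) (F : R -> dual) :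
  dsmooth a b F -> dsmooth a b (dderive F).
Proof. intros [h1 h2]; split; intros n; [apply (h1 (S n)) | apply (h2 (S n))]. Qed.

Lemma dderive_ext (a b : Rbar) (F G : R -> dual) (u : R) :
  (forall r, in_itv a b r -> F r = G r) -> in_itv a b u -> dderive F u = dderive G u.
Proof.
  intros H hu; unfold dderive; f_equal; apply (Derive_ext_itv a b); trivial;
    intros r hr; now rewrite H.
Qed.

Lemma dderive_const (x : dual) (u : R) : dderive (fun _ => x) u = dreal 0.
Proof. unfold dderive; now rewrite !Derive_const. Qed.

Lemma dderive_opp (F : R -> dual) (u : R) :
  dderive (fun r => - F r)%D u = (- dderive F u)%D.
Proof. unfold dderive, dopp; simpl; now rewrite !Derive_opp. Qed.

Lemma dderive_add (a b : Rbar) (F G : R -> dual) (u : R) :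
  dsmooth a b F -> dsmooth a b G -> in_itv a b u ->
  dderive (fun r => F r + G r)%D u = (dderive F u + dderive G u)%D.
Proof.
  intros [] [] hu; unfold dderive, dadd; simpl; f_equal;
    apply Derive_plus; now apply (smooth_ex_derive a b).
Qed.

Lemma dderive_mul (a b : Rbar) (F G : R -> dual) (u : R) :
  dsmooth a b F -> dsmooth a b G -> in_itv a b u ->
  dderive (fun r => F r * G r)%D u = (dderive F u * G u + F u * dderive G u)%D.
Proof.
  intros [] [] hu; unfold dderive, dadd, dmul; simpl; f_equal.
  - apply Derive_mult; now apply (smooth_ex_derive a b).
  - rewrite Derive_plus;
      [| apply ex_derive_mult; now apply (smooth_ex_derive a b) ..].
    rewrite !Derive_mult by now apply (smooth_ex_derive a b).
    ring.
Qed.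

Definition dvsmooth (a b : Rbar) (A : R -> dvec) : Prop :=
  dsmooth a b (fun r => dX (A r)) /\ dsmooth a b (fun r => dY (A r))
  /\ dsmooth a b (fun r => dZ (A r)).

Lemma dvsmooth_on_dvsmooth (a b : Rbar) (A : R -> dvec) :
  dvsmooth_on a b A -> dvsmooth a b A.
Proof.
  intros [(? & ? & ?) (? & ? & ?)]; repeat split; now apply smooth_on_smooth.
Qed.

Lemma dvsmooth_ext (a b : Rbar) (A B : R -> dvec) :
  (forall u, in_itv a b u -> A u = B u) -> dvsmooth a b A -> dvsmooth a b B.
Proof.
  intros H (hx & hy & hz); split; [|split].
  - apply (dsmooth_ext a b (fun r => dX (A r))); trivial; intros; f_equal; auto.
  - apply (dsmooth_ext a b (fun r => dY (A r))); trivial; intros; f_equal; auto.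
  - apply (dsmooth_ext a b (fun r => dZ (A r))); trivial; intros; f_equal; auto.
Qed.

Lemma dvsmooth_add (a b : Rbar) (A B : R -> dvec) :
  dvsmooth a b A -> dvsmooth a b B -> dvsmooth a b (fun u => A u + B u)%V.
Proof.
  intros (? & ? & ?) (? & ? & ?); split; [|split].
  - now apply (dsmooth_add a b (fun r => dX (A r)) (fun r => dX (B r))).
  - now apply (dsmooth_add a b (fun r => dY (A r)) (fun r => dY (B r))).
  - now apply (dsmooth_add a b (fun r => dZ (A r)) (fun r => dZ (B r))).
Qed.

Lemma dvsmooth_scal (a b : Rbar) (F : R -> dual) (A : R -> dvec) :
  dsmooth a b F -> dvsmooth a b A -> dvsmooth a b (fun u => F u *: A u)%V.
Proof.
  intros hF (hx & hy & hz); split; [|split].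
  - apply (dsmooth_ext a b (fun r => F r * dX (A r))%D);
      [intros; symmetry; apply dX_scal | now apply dsmooth_mul].
  - apply (dsmooth_ext a b (fun r => F r * dY (A r))%D);
      [intros; symmetry; apply dY_scal | now apply dsmooth_mul].
  - apply (dsmooth_ext a b (fun r => F r * dZ (A r))%D);
      [intros; symmetry; apply dZ_scal | now apply dsmooth_mul].
Qed.

Lemma dvsmooth_cross (a b : Rbar) (A B : R -> dvec) :
  dvsmooth a b A -> dvsmooth a b B -> dvsmooth a b (fun u => dvcross (A u) (B u)).
Proof.
  intros (ax & ay & az) (bx & by_ & bz); split; [|split].
  - apply (dsmooth_ext a b (fun r => dY (A r) * dZ (B r) + - (dZ (A r) * dY (B r)))%D);
      [intros; symmetry; apply dX_cross |].
    apply dsmooth_add; [|apply dsmooth_opp]; now apply dsmooth_mul.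
  - apply (dsmooth_ext a b (fun r => dZ (A r) * dX (B r) + - (dX (A r) * dZ (B r)))%D);
      [intros; symmetry; apply dY_cross |].
    apply dsmooth_add; [|apply dsmooth_opp]; now apply dsmooth_mul.
  - apply (dsmooth_ext a b (fun r => dX (A r) * dY (B r) + - (dY (A r) * dX (B r)))%D);
      [intros; symmetry; apply dZ_cross |].
    apply dsmooth_add; [|apply dsmooth_opp]; now apply dsmooth_mul.
Qed.

Lemma dsmooth_dot (a b : Rbar) (A B : R -> dvec) :
  dvsmooth a b A -> dvsmooth a b B -> dsmooth a b (fun u => dvdot (A u) (B u)).
Proof.
  intros (? & ? & ?) (? & ? & ?).
  eapply dsmooth_ext; [intros u _; symmetry; apply dvdot_coord|].
  repeat apply dsmooth_add; now apply dsmooth_mul.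
Qed.

Lemma dvsmooth_dvderive (a b : Rbar) (A : R -> dvec) :
  dvsmooth a b A -> dvsmooth a b (dvderive A).
Proof.
  intros (? & ? & ?); split; [|split].
  - now apply (dsmooth_dderive a b (fun r => dX (A r))).
  - now apply (dsmooth_dderive a b (fun r => dY (A r))).
  - now apply (dsmooth_dderive a b (fun r => dZ (A r))).
Qed.

Lemma dvderive_ext (a b : Rbar) (A B : R -> dvec) (u : R) :
  (forall r, in_itv a b r -> A r = B r) -> in_itv a b u -> dvderive A u = dvderive B u.
Proof.
  intros H hu; unfold dvderive, vderive; do 2 f_equal; apply (Derive_ext_itv a b); trivial;
    intros r hr; now rewrite H.
Qed.

Lemma dvderive_add (a b : Rbar) (A B : R -> dvec) (u : R) :
  dvsmooth a b A -> dvsmooth a b B -> in_itv a b u ->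
  dvderive (fun r => A r + B r)%V u = (dvderive A u + dvderive B u)%V.
Proof.
  intros (? & ? & ?) (? & ? & ?) hu; apply dvec_eq.
  - now apply (dderive_add a b (fun r => dX (A r)) (fun r => dX (B r))).
  - now apply (dderive_add a b (fun r => dY (A r)) (fun r => dY (B r))).
  - now apply (dderive_add a b (fun r => dZ (A r)) (fun r => dZ (B r))).
Qed.

Lemma dvderive_scal (a b : Rbar) (F : R -> dual) (A : R -> dvec) (u : R) :
  dsmooth a b F -> dvsmooth a b A -> in_itv a b u ->
  dvderive (fun r => F r *: A r)%V u = (dderive F u *: A u + F u *: dvderive A u)%V.
Proof.
  intros hF (? & ? & ?) hu; apply dvec_eq.
  - transitivity (dderive (fun r => F r * dX (A r))%D u).
    + apply (dderive_ext a b (fun r => dX (F r *: A r)%V)); trivial; intros; apply dX_scal.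
    + rewrite (dderive_mul a b) by trivial; unfold dX; dual_ext; simpl; ring.
  - transitivity (dderive (fun r => F r * dY (A r))%D u).
    + apply (dderive_ext a b (fun r => dY (F r *: A r)%V)); trivial; intros; apply dY_scal.
    + rewrite (dderive_mul a b) by trivial; unfold dY; dual_ext; simpl; ring.
  - transitivity (dderive (fun r => F r * dZ (A r))%D u).
    + apply (dderive_ext a b (fun r => dZ (F r *: A r)%V)); trivial; intros; apply dZ_scal.
    + rewrite (dderive_mul a b) by trivial; unfold dZ; dual_ext; simpl; ring.
Qed.

Lemma dderive_dot (a b : Rbar) (A B : R -> dvec) (u : R) :
  dvsmooth a b A -> dvsmooth a b B -> in_itv a b u ->
  dderive (fun r => dvdot (A r) (B r)) u
  = (dvdot (dvderive A u) (B u) + dvdot (A u) (dvderive B u))%D.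
Proof.
  intros (? & ? & ?) (? & ? & ?) hu.
  rewrite (dderive_ext a b _
    (fun r => dX (A r) * dX (B r) + dY (A r) * dY (B r) + dZ (A r) * dZ (B r))%D)
    by (trivial; intros; apply dvdot_coord).
  rewrite (dderive_add a b); trivial;
    [| apply dsmooth_add |]; try (apply dsmooth_mul; trivial).
  rewrite (dderive_add a b) by (trivial; now apply dsmooth_mul).
  rewrite !(dderive_mul a b) by trivial.
  rewrite !dvdot_coord; unfold dderive, dvderive, vderive, dX, dY, dZ; dual_ext; simpl; ring.
Qed.

(** * Dual arc-length and the Darboux frame *)

Definition regular (a b : Rbar) (e : R -> dvec) : Prop :=
  dvsmooth a b e /\ forall u, in_itv a b u -> vre (dvderive e u) <> vzero.

(** This is the derivative of the dual arc-length in the parameter [u], as [dderive_dual_arclen]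
    confirms. *)
Definition speed (e : R -> dvec) (u : R) : dual := dvnorm (dvderive e u).

Lemma dsmooth_norm (a b : Rbar) (A : R -> dvec) :
  dvsmooth a b A -> (forall u, in_itv a b u -> vre (A u) <> vzero) ->
  dsmooth a b (fun u => dvnorm (A u)).
Proof.
  intros hA h0; apply (dsmooth_ext a b (fun u => dlift sqrt (dvdot (A u) (A u)))).
  - intros u hu; symmetry; apply dvnorm_sqrt; auto.
  - apply dsmooth_sqrt; [intros u hu; apply dvdot_self_pos; auto | now apply dsmooth_dot].
Qed.

Lemma dsmooth_speed (a b : Rbar) (e : R -> dvec) :
  regular a b e -> dsmooth a b (speed e).
Proof.
  intros [hs h0]; apply dsmooth_norm; trivial; now apply dvsmooth_dvderive.
Qed.

Lemma speed_pos (a b : Rbar) (e : R -> dvec) (u : R) :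
  regular a b e -> in_itv a b u -> 0 < re (speed e u).
Proof. intros [_ h0] hu; now apply dvnorm_pos, h0. Qed.

Lemma Derive_arclen (a b : Rbar) (u0 u : R) (e : R -> dvec) :
  in_itv a b u0 -> regular a b e -> in_itv a b u ->
  Derive (arclen u0 e) u = re (speed e u).
Proof.
  intros hu0 he hu; apply (Derive_RInt_itv a b u0 u (fun r => re (speed e r))); trivial.
  now apply dsmooth_speed.
Qed.

(** The norm of de/ds is the speed divided by ds/du, so the factor ds/du in the integrand cancels
    and leaves the speed. The fundamental theorem of calculus then applies to each component. *)
Lemma dderive_dual_arclen (a b : Rbar) (u0 u : R) (e : R -> dvec) :
  in_itv a b u0 -> regular a b e -> in_itv a b u ->
  dderive (dual_arclen u0 e) u = speed e u.
Proof.
  intros hu0 he hu.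
  assert (hF : forall r, in_itv a b r -> speed e r =
    (dvnorm (dv_ds u0 e e r) * dreal (Derive (arclen u0 e) r))%D).
  { intros r hr; unfold dv_ds; rewrite (Derive_arclen a b) by trivial.
    assert (hp := speed_pos a b e r he hr).
    set (s := re (speed e r)) in *.
    assert (hs : dinv (dreal s) = dreal (/ s)).
    { apply dinv_unique; rewrite <- dreal_mul; f_equal; field; lra. }
    (* The positive real scalar [/ s] comes out of the norm: the candidate has real part [/ s * s]
       and the right square. *)
    rewrite hs, (dvnorm_unique _ (dreal (/ s) * speed e r)%D).
    - transitivity ((dreal (/ s) * dreal s) * speed e r)%D; [|ring].
      rewrite <- dreal_mul, Rinv_l by lra; ring.
    - apply (Rmult_lt_0_compat (/ s) s); trivial; now apply Rinv_0_lt_compat.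
    - rewrite dvdot_scal_l, dvdot_scal_r, <- dvnorm_sqr by (apply he; trivial).
      fold (speed e r); ring. }
  assert (hs : dsmooth a b (fun r => (dvnorm (dv_ds u0 e e r)
                                      * dreal (Derive (arclen u0 e) r))%D)).
  { apply (dsmooth_ext a b (speed e)); trivial; now apply dsmooth_speed. }
  rewrite hF by trivial; unfold dderive, dual_arclen, dRInt; destruct hs as [h1 h2].
  apply (f_equal2 Dual); [exact (Derive_RInt_itv a b u0 u _ hu0 hu h1)
                         | exact (Derive_RInt_itv a b u0 u _ hu0 hu h2)].
Qed.

Lemma dinv_d_ds_dual_arclen (a b : Rbar) (u0 u : R) (e : R -> dvec) :
  in_itv a b u0 -> regular a b e -> in_itv a b u ->
  (dinv (d_ds u0 e (dual_arclen u0 e) u) * dinv (dreal (Derive (arclen u0 e) u))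
   = dinv (speed e u))%D.
Proof.
  intros hu0 he hu; unfold d_ds, ddiv.
  rewrite (Derive_arclen a b), (dderive_dual_arclen a b) by trivial.
  assert (hp := speed_pos a b e u he hu).
  assert (h1 := dmul_dinv (speed e u) ltac:(lra)).
  assert (h2 := dmul_dinv (dreal (re (speed e u))) (Rgt_not_eq _ _ hp)).
  set (x := dinv (dreal _)) in *; set (y := dreal (re _)) in *.
  rewrite (dinv_unique (speed e u * x)%D (y * dinv (speed e u))%D).
  - transitivity ((y * x) * dinv (speed e u))%D; [ring | rewrite h2; ring].
  - transitivity ((speed e u * dinv (speed e u)) * (y * x))%D; [ring | rewrite h1, h2; ring].
Qed.

(** The real arc-length drops out of (dF/ds) / (dsbar/ds). From here on only [speed] and derivatives
    in [u] occur, and the base point [u0] has no influence on the value. *)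
Lemma dv_dsbar_speed (a b : Rbar) (u0 u : R) (e F : R -> dvec) :
  in_itv a b u0 -> regular a b e -> in_itv a b u ->
  dv_dsbar u0 e F u = (dinv (speed e u) *: dvderive F u)%V.
Proof.
  intros hu0 he hu; unfold dv_dsbar, dv_ds.
  now rewrite dvscal_dvscal, (dinv_d_ds_dual_arclen a b) by trivial.
Qed.

Lemma d_dsbar_speed (a b : Rbar) (u0 u : R) (e : R -> dvec) (F : R -> dual) :
  in_itv a b u0 -> regular a b e -> in_itv a b u ->
  d_dsbar u0 e F u = (dinv (speed e u) * dderive F u)%D.
Proof.
  intros hu0 he hu; rewrite <- (dinv_d_ds_dual_arclen a b u0 u e) by trivial.
  unfold d_dsbar; unfold d_ds at 1; unfold ddiv; ring.
Qed.

Lemma dvsmooth_darboux_t (a b : Rbar) (u0 : R) (e : R -> dvec) :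
  in_itv a b u0 -> regular a b e -> dvsmooth a b (darboux_t u0 e).
Proof.
  intros hu0 he.
  apply (dvsmooth_ext a b (fun r => dinv (speed e r) *: dvderive e r)%V).
  - intros r hr; symmetry; exact (dv_dsbar_speed a b u0 r e e hu0 he hr).
  - apply dvsmooth_scal; [|apply dvsmooth_dvderive, he].
    apply dsmooth_dinv; [|now apply dsmooth_speed].
    intros r hr; pose proof (speed_pos a b e r he hr); lra.
Qed.

Lemma dvderive_speed (a b : Rbar) (u0 u : R) (e F : R -> dvec) :
  in_itv a b u0 -> regular a b e -> in_itv a b u ->
  dvderive F u = (speed e u *: dv_dsbar u0 e F u)%V.
Proof.
  intros hu0 he hu; rewrite (dv_dsbar_speed a b), dvscal_dvscal by trivial.
  pose proof (speed_pos a b e u he hu).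
  now rewrite dmul_dinv, dvscal_1 by lra.
Qed.

(** Differentiating the constant product of [e] with itself makes the velocity orthogonal to [e];
    dividing the velocity by its norm makes it a unit vector. *)
Lemma darboux_orthonormal (a b : Rbar) (u0 u : R) (e : R -> dvec) :
  in_itv a b u0 -> regular a b e ->
  (forall r, in_itv a b r -> on_dual_sphere (e r)) -> in_itv a b u ->
  dvdot (e u) (darboux_t u0 e u) = dreal 0 /\
  dvdot (darboux_t u0 e u) (darboux_t u0 e u) = dreal 1.
Proof.
  intros hu0 he hS hu.
  assert (hp := speed_pos a b e u he hu).
  assert (hinv := dmul_dinv (speed e u) ltac:(lra)).
  unfold darboux_t; rewrite (dv_dsbar_speed a b), !dvdot_scal_r, ?dvdot_scal_l by trivial.
  split.
  - assert (h : dderive (fun r => dvdot (e r) (e r)) u = dreal 0).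
    { rewrite (dderive_ext a b _ (fun _ => dreal 1)) by trivial; apply dderive_const. }
    rewrite (dderive_dot a b) in h by (trivial; apply he).
    assert (h0 : dvdot (e u) (dvderive e u) = dreal 0).
    { transitivity (dreal (/ 2) * (dvdot (dvderive e u) (e u)
                                   + dvdot (e u) (dvderive e u)))%D.
      - dvec_ext; field.
      - rewrite h; ring. }
    rewrite h0; ring.
  - rewrite <- dvnorm_sqr by (apply he; trivial); fold (speed e u).
    transitivity ((speed e u * dinv (speed e u)) * (speed e u * dinv (speed e u)))%D;
      [ring | rewrite hinv; ring].
Qed.

(** Pair the equation for dt/dsbar with g: g is orthogonal to e and has unit length by Lagrange's
    identity. The curvature becomes an explicit expression in the curve. *)
Lemma spherical_curvature_dot (a b : Rbar) (u0 u : R) (e : R -> dvec) (gamma : R -> dual) :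
  in_itv a b u0 -> regular a b e ->
  (forall r, in_itv a b r -> on_dual_sphere (e r)) ->
  is_dual_spherical_curvature a b u0 e gamma -> in_itv a b u ->
  gamma u = dvdot (dv_dsbar u0 e (darboux_t u0 e) u) (darboux_g u0 e u).
Proof.
  intros hu0 he hS hg hu.
  destruct (darboux_orthonormal a b u0 u e) as [het htt]; trivial.
  assert (hee : dvdot (e u) (e u) = dreal 1) by (now apply hS).
  destruct (hg u hu) as [-> _].
  rewrite dvdot_sub_l, dvdot_scal_l; unfold darboux_g.
  rewrite dvdot_cross_cross, dvdot_cross_l, hee, htt, het; ring.
Qed.

(** The Darboux equations say nothing on regularity of [gamma]; it comes from writing [gamma] as an
    inner product of smooth curves. *)
Lemma dsmooth_curvature (a b : Rbar) (u0 : R) (e : R -> dvec) (gamma : R -> dual) :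
  in_itv a b u0 -> regular a b e ->
  (forall r, in_itv a b r -> on_dual_sphere (e r)) ->
  is_dual_spherical_curvature a b u0 e gamma -> dsmooth a b gamma.
Proof.
  intros hu0 he hS hg.
  assert (ht := dvsmooth_darboux_t a b u0 e hu0 he).
  eapply dsmooth_ext.
  - intros r hr; symmetry; exact (spherical_curvature_dot a b u0 r e gamma hu0 he hS hg hr).
  - apply dsmooth_dot; [|apply dvsmooth_cross; trivial; apply he].
    apply (dvsmooth_ext a b (fun r => dinv (speed e r) *: dvderive (darboux_t u0 e) r)%V).
    + intros r hr; symmetry; exact (dv_dsbar_speed a b u0 r e _ hu0 he hr).
    + apply dvsmooth_scal; [|now apply dvsmooth_dvderive].
      apply dsmooth_dinv; [|now apply dsmooth_speed].
      intros r hr; pose proof (speed_pos a b e r he hr); lra.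
Qed.

(** * Linear combinations of the Darboux frame *)

Definition frame_comb (E T : dvec) (x y z : dual) : dvec :=
  (x *: E + (y *: T + z *: dvcross E T))%V.

Lemma dvscal_comb (E T : dvec) (k x y z : dual) :
  (k *: frame_comb E T x y z)%V = frame_comb E T (k * x) (k * y) (k * z).
Proof. unfold frame_comb; dvec_ring. Qed.

Lemma dvdot_comb (E T : dvec) (x y z x' y' z' : dual) :
  dvdot E E = dreal 1 -> dvdot E T = dreal 0 -> dvdot T T = dreal 1 ->
  dvdot (frame_comb E T x y z) (frame_comb E T x' y' z')
  = (x * x' + y * y' + z * z')%D.
Proof.
  intros hEE hET hTT.
  transitivity (x * x' * dvdot E E + y * y' * dvdot T T
    + (x * y' + y * x') * dvdot E T
    + z * z' * (dvdot E E * dvdot T T + - (dvdot E T * dvdot E T)))%D.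
  - unfold frame_comb; dvec_ring.
  - rewrite hEE, hET, hTT; ring.
Qed.

(** The double products such as T x (E x T) expand through the Gram entries of E and T. Keeping
    those entries symbolic gives a pure ring identity, into which orthonormality is substituted. *)
Lemma dvcross_comb (E T : dvec) (x y z x' y' z' : dual) :
  dvdot E E = dreal 1 -> dvdot E T = dreal 0 -> dvdot T T = dreal 1 ->
  dvcross (frame_comb E T x y z) (frame_comb E T x' y' z')
  = frame_comb E T (y * z' + - (z * y')) (z * x' + - (x * z')) (x * y' + - (y * x')).
Proof.
  intros hEE hET hTT.
  transitivity
    (frame_comb E T
      ((y * z' + - (z * y')) * dvdot T T + (x * z' + - (z * x')) * dvdot E T)
      ((z * x' + - (x * z')) * dvdot E E + (z * y' + - (y * z')) * dvdot E T)
      (x * y' + - (y * x')))%D.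
  - unfold frame_comb; dvec_ring.
  - rewrite hEE, hET, hTT; f_equal; ring.
Qed.

(** The Darboux equations, in the coordinates of the moving frame. *)
Lemma dvderive_comb (a b : Rbar) (u0 u : R) (e : R -> dvec) (gamma x y z : R -> dual) :
  in_itv a b u0 -> regular a b e ->
  is_dual_spherical_curvature a b u0 e gamma -> in_itv a b u ->
  dsmooth a b x -> dsmooth a b y -> dsmooth a b z ->
  dvderive (fun r => frame_comb (e r) (darboux_t u0 e r) (x r) (y r) (z r)) u
  = frame_comb (e u) (darboux_t u0 e u)
      (dderive x u + - (speed e u * y u))%D
      (dderive y u + speed e u * (x u + - (gamma u * z u)))%D
      (dderive z u + speed e u * (gamma u * y u))%D.
Proof.
  intros hu0 he hgam hu hx hy hz.
  assert (hse : dvsmooth a b e) by apply he.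
  assert (hst := dvsmooth_darboux_t a b u0 e hu0 he).
  assert (hsg : dvsmooth a b (darboux_g u0 e)) by (now apply dvsmooth_cross).
  unfold frame_comb; fold (darboux_g u0 e u).
  change (dvderive (fun r => x r *: e r
    + (y r *: darboux_t u0 e r + z r *: darboux_g u0 e r))%V u = 
    (dderive x u + - (speed e u * y u))%D *: e u
    + ((dderive y u + speed e u * (x u + - (gamma u * z u)))%D *: darboux_t u0 e u
    + (dderive z u + speed e u * (gamma u * y u))%D *: darboux_g u0 e u))%V.
  rewrite (dvderive_add a b); trivial;
    [|now apply dvsmooth_scal|apply dvsmooth_add; now apply dvsmooth_scal].
  rewrite (dvderive_add a b) by (trivial; now apply dvsmooth_scal).
  rewrite !(dvderive_scal a b) by trivial.
  destruct (hgam u hu) as [h1 h2].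
  rewrite (dvderive_speed a b u0 u e e), (dvderive_speed a b u0 u e (darboux_t u0 e)),
    (dvderive_speed a b u0 u e (darboux_g u0 e)), h1, h2 by trivial.
  fold (darboux_t u0 e u).
  (* With every function value an independent atom, what remains is linear algebra over the dual
     ring. *)
  generalize (darboux_t u0 e u) (darboux_g u0 e u) (e u) (speed e u) (gamma u)
    (x u) (y u) (z u) (dderive x u) (dderive y u) (dderive z u).
  clear; intros; dvec_ring.
Qed.

(** * Curvature of the Smarandache curve *)

Theorem theorem5p3 (a b : Rbar) (u0 : R) (hu0 : in_itv a b u0)
  (e : R -> dvec) (gamma gamma1 : R -> dual)
  (he : regular_dual_spherical_curve a b e)
  (hgamma : is_dual_spherical_curvature a b u0 e gamma)
  (hgamma1 : is_dual_spherical_curvature a b u0 (smarandache_et u0 e) gamma1) :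
  forall u : R, in_itv a b u ->
    gamma1 u =
    ((gamma u ^ 3 + dreal 2 * d_dsbar u0 e gamma u + dreal 2 * gamma u)
     / dlift (fun x : R => Rpower x (3 / 2)) (dreal 2 + gamma u ^ 2))%D.
Proof.
  destruct he as [hsm [hS h0]].
  assert (hreg : regular a b e) by (split; [now apply dvsmooth_on_dvsmooth | exact h0]).
  assert (hort := fun u hu => darboux_orthonormal a b u0 u e hu0 hreg hS hu).
  assert (hgs : dsmooth a b gamma) by (now apply (dsmooth_curvature a b u0 e)).
  set (t := darboux_t u0 e) in *; set (lam := speed e).
  assert (hD : forall r x y z, in_itv a b r ->
    dsmooth a b x -> dsmooth a b y -> dsmooth a b z ->
    dvderive (fun q => frame_comb (e q) (t q) (x q) (y q) (z q)) r
    = frame_comb (e r) (t r)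
        (dderive x r + - (lam r * y r))%D
        (dderive y r + lam r * (x r + - (gamma r * z r)))%D
        (dderive z r + lam r * (gamma r * y r))%D).
  { intros r x y z; exact (dvderive_comb a b u0 r e gamma x y z hu0 hreg hgamma). }
  set (c := dreal (1 / sqrt 2)).
  assert (hc0 : 0 < re c).
  { simpl; apply Rdiv_lt_0_compat; [lra | apply sqrt_lt_R0; lra]. }
  (* With its positivity, this is all that the computation uses about the factor [1 / sqrt 2]. *)
  assert (hcc : (dreal 2 * (c * c))%D = dreal 1).
  { unfold c; rewrite <- !dreal_mul; f_equal.
    replace (2 * (1 / sqrt 2 * (1 / sqrt 2))) with (2 / (sqrt 2 * sqrt 2))
      by (field; apply Rgt_not_eq, sqrt_lt_R0; lra).
    rewrite sqrt_sqrt by lra; field. }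
  set (q := fun r => (dreal 2 + gamma r ^ 2)%D).
  assert (hq : forall r, 0 < re (q r)).
  { intros r; unfold q; simpl; pose proof (Rle_0_sqr (re (gamma r))); unfold Rsqr in *; lra. }
  set (rho := fun r => dlift sqrt (q r)).
  assert (hrho0 : forall r, 0 < re (rho r)).
  { intros r; apply sqrt_lt_R0, hq. }
  assert (hrr : forall r, (rho r * rho r)%D = q r).
  { intros r; apply dlift_sqrt_sqr, hq. }
  set (p := fun r => dinv (rho r)).
  assert (hrp : forall r, (rho r * p r)%D = dreal 1).
  { intros r; apply dmul_dinv; specialize (hrho0 r); lra. }
  assert (hlam0 : forall r, in_itv a b r -> 0 < re (lam r)).
  { intros r hr; now apply dvnorm_pos, h0. }
  assert (hqs : dsmooth a b q).
  { unfold q; simpl; apply dsmooth_add; [apply dsmooth_const|].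
    repeat apply dsmooth_mul; trivial; apply dsmooth_const. }
  assert (hps : dsmooth a b p).
  { apply dsmooth_dinv; [intros r _; specialize (hrho0 r); lra|].
    apply dsmooth_sqrt; trivial; intros r _; apply hq. }
  set (e1 := smarandache_et u0 e).
  assert (he1 : forall r, e1 r = frame_comb (e r) (t r) c c (dreal 0)).
  { intros r; unfold e1, smarandache_et; fold (t r) c; unfold frame_comb.
    dvec_ring. }
  assert (hDe1 : forall r, in_itv a b r -> dvderive e1 r = 
    frame_comb (e r) (t r) (- (c * lam r)) (c * lam r) (c * lam r * gamma r)).
  { intros r hr; rewrite (dvderive_ext a b _ _ r (fun r' _ => he1 r')) by trivial.
    rewrite (hD r (fun _ => c) (fun _ => c) (fun _ => dreal 0))
      by (trivial; apply dsmooth_const).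
    rewrite !dderive_const; f_equal; ring. }
  (* The frame coordinates of the velocity are c lam times (-1, 1, gamma), whose squares sum to c²
     lam² (2 + gamma²). *)
  assert (hnn : forall r, in_itv a b r -> dvdot (dvderive e1 r) (dvderive e1 r)
    = (c * lam r * rho r * (c * lam r * rho r))%D).
  { intros r hr; destruct (hort r hr) as [h1 h2].
    rewrite hDe1, (dvdot_comb _ _ _ _ _ _ _ _ (hS r hr) h1 h2) by trivial.
    transitivity (c * lam r * (c * lam r) * (rho r * rho r))%D; [|ring].
    rewrite hrr; unfold q; simpl; rewrite dreal_2; ring. }
  assert (hpos : forall r, in_itv a b r -> 0 < re (c * lam r * rho r)%D).
  { intros r hr; specialize (hlam0 r hr); specialize (hrho0 r).
    change (0 < re c * re (lam r) * re (rho r)).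
    apply Rmult_lt_0_compat; [apply Rmult_lt_0_compat|]; trivial. }
  assert (hlam1 : forall r, in_itv a b r -> speed e1 r = (c * lam r * rho r)%D).
  { intros r hr; apply dvnorm_unique; auto. }
  assert (hst : dvsmooth a b t) by (now apply dvsmooth_darboux_t).
  (* Regularity of [e1] follows from the positive real part of its squared speed, and opens the
     frame lemmas to [e1]. *)
  assert (hreg1 : regular a b e1).
  { split.
    - apply dvsmooth_scal; [apply dsmooth_const | apply dvsmooth_add; trivial; apply hreg].
    - intros r hr; apply vre_neq0; rewrite hnn by trivial.
      exact (Rmult_lt_0_compat _ _ (hpos r hr) (hpos r hr)). }
  assert (hS1 : forall r, in_itv a b r -> on_dual_sphere (e1 r)).
  { intros r hr; destruct (hort r hr) as [h1 h2]; unfold on_dual_sphere.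
    rewrite he1, (dvdot_comb _ _ _ _ _ _ _ _ (hS r hr) h1 h2).
    change (Dual 1 0) with (dreal 1); rewrite <- hcc, dreal_2; ring. }
  assert (ht1 : forall r, in_itv a b r -> darboux_t u0 e1 r
    = frame_comb (e r) (t r) (- p r) (p r) (p r * gamma r)).
  { intros r hr; unfold darboux_t; rewrite (dv_dsbar_speed a b), hDe1, hlam1 by trivial.
    rewrite dvscal_comb.
    assert (hi : (dinv (c * lam r * rho r) * (c * lam r))%D = p r).
    { symmetry; apply dinv_unique.
      specialize (hpos r hr).
      transitivity (c * lam r * rho r * dinv (c * lam r * rho r))%D; [ring|].
      apply dmul_dinv; lra. }
    rewrite <- hi; f_equal; ring. }
  intros u hu.
  destruct (hort u hu) as [h1 h2].
  rewrite (spherical_curvature_dot a b u0 u e1) by trivial.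
  rewrite (dv_dsbar_speed a b), (dvderive_ext a b _ _ u ht1) by trivial.
  (* The terms with the derivative of [p] are multiples of (-1, 1, gamma), hence of t1. They vanish
     against g1, whose coordinates are c p (gamma, -gamma, 2), so that derivative is never
     computed. *)
  rewrite (hD u (fun r => - p r)%D p (fun r => p r * gamma r)%D)
    by (trivial; try apply dsmooth_opp; try apply dsmooth_mul; trivial).
  unfold darboux_g; rewrite he1, ht1 by trivial.
  rewrite (dvcross_comb _ _ _ _ _ _ _ _ (hS u hu) h1 h2), dvscal_comb, (dvdot_comb _ _ _ _ _ _ _ _ (hS u hu) h1 h2).
  rewrite (d_dsbar_speed a b), hlam1 by trivial; fold (lam u).
  rewrite (dderive_mul a b p gamma) by trivial.
  rewrite dderive_opp.
  (* Writing the base as a square turns its 3/2 power into the cube of [rho], with inverse the cube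
     of [p]. *)
  assert (hden : (dreal 2 + gamma u ^ 2)%D = (rho u * rho u)%D) by (symmetry; apply hrr).
  rewrite hden, dlift_Rpower_sqr by trivial; unfold ddiv.
  specialize (hlam0 u hu); specialize (hrp u).
  assert (hli := dmul_dinv (lam u) (Rgt_not_eq _ _ hlam0)).
  set (i := dinv (lam u)) in *.
  (* Since 2c² = 1, the inverse of [c] is 2c. *)
  rewrite (dinv_unique (c * lam u * rho u)%D (dreal 2 * c * i * p u)%D).
  2: { transitivity (dreal 2 * (c * c) * (lam u * i) * (rho u * p u))%D;
       [ring | rewrite hcc, hli, hrp; ring]. }
  rewrite (dinv_unique (rho u * (rho u * rho u))%D (p u * (p u * p u))%D).
  2: { transitivity ((rho u * p u) * ((rho u * p u) * (rho u * p u)))%D;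
       [ring | rewrite hrp; ring]. }
  (* The middle expression isolates the factors 2c² and [lam u * i], both equal to 1. *)
  transitivity (dreal 2 * (c * c) * (p u * (p u * p u))
    * ((lam u * i) * (gamma u * (gamma u * gamma u) + dreal 2 * gamma u)
       + dreal 2 * (i * dderive gamma u)))%D.
  - rewrite dreal_2; ring.
  - rewrite hcc, hli; simpl; ring.
Qed.
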